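(* Let $\Omega\subsetneq\mathbb{R}^n$ be a domain and let $1<p<\infty$. Consider the segment-based criterion (S) defined in the context. (i) If $\lambda>n-1$, then no domain satisfies (S), for any choice of $c_0>0$, $C_0\ge2$ and $\alpha\in(0,1]$. (ii) If $0\le\lambda\le n-1$ and $\Omega$ satisfies (S), then $\Omega$ satisfies the density condition (D) defined in the context with the same exponent $\lambda$ and constant $c_0C_0^{-\lambda}$, that is, $$\mathcal H^\lambda_\infty\bigl(\partial\Omega\cap B(x,2d_\Omega(x))\bigr)\ge c_0C_0^{-\lambda}\,d_\Omega(x)^\lambda\qquad\text{for every }x\in\Omega,$$ and consequently $\Omega$ admits the $(p,\beta)$-Hardy inequality for all $\beta<p-n+\lambda$. In particular, a segment-based criterion never yields a $(p,\beta)$-Hardy inequality with $\beta\ge p-1$, and in the range $\beta<p-1$ where it applies it yields nothing beyond Lehrbäck's density theorem (stated in the context), whose hypothesis (D) involves no visibility whatsoever.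
   Context: Let $d_\Omega(y):=\operatorname{dist}(y,\partial\Omega)$ and let $B(y,r)$ be the open ball. For $x\ne\xi$, $[x,\xi):=\{(1-t)x+t\xi:0\le t<1\}$. For $x\in\Omega$ and $\alpha\in(0,1]$, the quantitatively straight visible boundary is $$\partial^{\mathrm{str}}_{x,\alpha}\Omega:=\bigl\{\xi\in\partial\Omega:\ [x,\xi)\subset\Omega\ \text{ and }\ d_\Omega((1-t)x+t\xi)\ge\alpha\min\{t,1-t\}|x-\xi|\ \text{ for every }t\in(0,1)\bigr\}.$$ The $\lambda$-Hausdorff content of $E\subset\mathbb{R}^n$ is $\mathcal H^\lambda_\infty(E):=\inf\{\sum_{i=1}^\infty r_i^\lambda: E\subset\bigcup_{i=1}^\infty B(x_i,r_i)\}$. A segment-based criterion means the hypothesis $$(\mathrm{S})\qquad \mathcal H^\lambda_\infty\bigl(\partial^{\mathrm{str}}_{x,\alpha}\Omega\cap B(x,C_0d_\Omega(x))\bigr)\ge c_0\,d_\Omega(x)^\lambda\qquad\text{for every }x\in\Omega,$$ with constants $c_0>0$, $C_0\ge2$, $\alpha\in(0,1]$ and an exponent $0\le\lambda\le n$. For $1<p<\infty$ and $\beta\in\mathbb{R}$, $\Omega$ admits the $(p,\beta)$-Hardy inequality if there is a constant $C>0$ with $$\int_\Omega |u(x)|^p d_\Omega(x)^{\beta-p}\,dx\le C\int_\Omega|\nabla u(x)|^p d_\Omega(x)^\beta\,dx\qquad\text{for every }u\in C_c^\infty(\Omega).$$ The density condition with exponent $\lambda$ and constant $c>0$ is $$(\mathrm{D})\qquad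 \mathcal H^\lambda_\infty\bigl(\partial\Omega\cap B(x,2d_\Omega(x))\bigr)\ge c\,d_\Omega(x)^\lambda\qquad\text{for every }x\in\Omega.$$ Lehrbäck's density theorem (a known result): if $\Omega\subset\mathbb{R}^n$ is open, $1<p<\infty$, and (D) holds for some $0\le\lambda\le n-1$ and $c>0$, then $\Omega$ admits the $(p,\beta)$-Hardy inequality for all $\beta<p-n+\lambda$. *)

(* Defs.v *)
From HB Require Import structures.
From mathcomp Require Import all_boot all_order all_algebra.
From mathcomp Require Import all_classical all_reals all_analysis.

Set Implicit Arguments.
Unset Strict Implicit.
Unset Printing Implicit Defensive.

Import Order.TTheory GRing.Theory Num.Theory.
Import numFieldNormedType.Exports.

Local Open Scope classical_set_scope.
Local Open Scope ring_scope.

(* The norm that the library puts on 'rV[R]_n is the sup norm.  It induces the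
   usual topology, so [open], [closure], [compact], [connected], [continuous]
   are the library's; but every metric notion below (distance, balls, length
   of the gradient) is built on the Euclidean norm. *)
Definition enorm (R : realType) (n : nat) (x : 'rV[R]_n) : R :=
  Num.sqrt (\sum_(i < n) x ord0 i ^+ 2).

Definition eball (R : realType) (n : nat) (x : 'rV[R]_n) (r : R) :
    set 'rV[R]_n :=
  [set y | enorm (y - x) < r].

Definition boundary (T : topologicalType) (A : set T) : set T :=
  closure A `\` interior A.

Definition domain (T : topologicalType) (A : set T) : Prop :=
  [/\ open A, connected A & A !=set0].

(* Only used for sets with nonempty boundary ([inf set0] is 0). *)
Definition bdist (R : realType) (n : nat) (Omega : set 'rV[R]_n)
    (y : 'rV[R]_n) : R :=
  inf [set enorm (y - xi) | xi in boundary Omega].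

Definition straight_boundary (R : realType) (n : nat) (Omega : set 'rV[R]_n)
    (x : 'rV[R]_n) (alpha : R) : set 'rV[R]_n :=
  [set xi | [/\ boundary Omega xi,
    forall t : R, 0 <= t < 1 -> Omega ((1 - t) *: x + t *: xi) &
    forall t : R, 0 < t < 1 ->
      alpha * Num.min t (1 - t) * enorm (x - xi)
        <= bdist Omega ((1 - t) *: x + t *: xi)]].

(* A ball of radius 0 is empty and contributes 0 to the sum, so that a cover by
   finitely many balls can be padded to a sequence.  The test on [r i] only
   matters for lambda = 0, since [0 `^ 0 = 1] in the library. *)
Definition hausdorff_content (R : realType) (n : nat) (lambda : R)
    (E : set 'rV[R]_n) : \bar R :=
  ereal_inf [set s | exists (c : nat -> 'rV[R]_n) (r : nat -> R),
    [/\ forall i, 0 <= r i,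
        E `<=` \bigcup_i eball (c i) (r i) &
        s = (\sum_(0 <= i <oo)
               (if r i == 0 then 0 else r i `^ lambda)%:E)%E]].

Definition segment_criterion (R : realType) (n : nat) (Omega : set 'rV[R]_n)
    (lambda c0 C0 alpha : R) : Prop :=
  [/\ 0 < c0, 2 <= C0, 0 < alpha <= 1, 0 <= lambda <= n%:R &
    forall x, Omega x ->
      ((c0 * bdist Omega x `^ lambda)%:E <=
       hausdorff_content lambda
         (straight_boundary Omega x alpha `&`
          eball x (C0 * bdist Omega x)))%E].

Definition density_condition (R : realType) (n : nat) (Omega : set 'rV[R]_n)
    (lambda c : R) : Prop :=
  0 < c /\
  forall x, Omega x ->
    ((c * bdist Omega x `^ lambda)%:E <=
     hausdorff_content lambda
       (boundary Omega `&` eball x (2 * bdist Omega x)))%E.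

Definition partial (R : realType) (n : nat) (i : 'I_n) (u : 'rV[R]_n -> R) :
    'rV[R]_n -> R :=
  fun x => 'D_(delta_mx ord0 i) u x.

Definition grad (R : realType) (n : nat) (u : 'rV[R]_n -> R) (x : 'rV[R]_n) :
    'rV[R]_n :=
  \row_(i < n) partial i u x.

Fixpoint Ck (R : realType) (n : nat) (k : nat) (u : 'rV[R]_n -> R) : Prop :=
  continuous u /\
  (if k is k'.+1 then
     forall i : 'I_n, (forall x, derivable u x (delta_mx ord0 i)) /\
                      Ck k' (partial i u)
   else True).

(* C_c^oo(Omega), its elements being extended by 0 to the whole space. *)
Definition test_function (R : realType) (n : nat) (Omega : set 'rV[R]_n)
    (u : 'rV[R]_n -> R) : Prop :=
  [/\ forall k, Ck k u,
      compact (closure [set x | u x != 0]) &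
      closure [set x | u x != 0] `<=` Omega].

Definition tuple_cons (T : Type) (n : nat) (p : T * n.-tuple T) :
    n.+1.-tuple T :=
  [tuple of p.1 :: p.2].

(* n-dimensional Lebesgue measure, carried by n-tuples because that is the form
   of R^n to which the library gives a product sigma-algebra. *)
Fixpoint lebesgue_tuple (R : realType) (n : nat) :
    set (n.-tuple (measurableTypeR R)) -> \bar R :=
  match n with
  | 0 => dirac [tuple]
  | n'.+1 => pushforward
      (product_measure1 (@lebesgue_measure R) (@lebesgue_tuple R n'))
      (@tuple_cons (measurableTypeR R) n')
  end.
Arguments lebesgue_tuple R n : clear implicits, simpl never.

Lemma measurable_tuple_cons d (T : measurableType d) (n : nat) :
  measurable_fun setT (@tuple_cons T n).
Proof.
rewrite /tuple_cons.
exact: (measurable_cons measurable_fst measurable_snd).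
Qed.

Lemma measurable_tuple_uncons d (T : measurableType d) (n : nat) :
  measurable_fun setT (fun t : n.+1.-tuple T => (thead t, [tuple of behead t])).
Proof.
apply/measurable_fun_pairP; split => /=.
- exact: (measurable_tnth ord0).
- exact: measurable_behead.
Qed.

Section cons_measure.
Context (R : realType) (n : nat).
Local Notation T := (measurableTypeR R).
Variable m : {sigma_finite_measure set (n.-tuple T) -> \bar R}.

Definition cons_measure : set (n.+1.-tuple T) -> \bar R :=
  pushforward (product_measure1 (@lebesgue_measure R) m) (@tuple_cons T n).

Let mtc : measurable_fun setT (@tuple_cons T n) := @measurable_tuple_cons _ _ n.

Let cons_measure0 : cons_measure set0 = 0%E.
Proof. exact: measure0. Qed.

Let cons_measure_ge0 A : (0 <= cons_measure A)%E.
Proof. exact: measure_ge0. Qed.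

Let cons_measure_sigma_additive : semi_sigma_additive cons_measure.
Proof.
have := @measure_semi_sigma_additive _ _ _
  (measure_function_pushforward__canonical__measure_function_Measure
     (product_measure1 (@lebesgue_measure R) m) mtc).
exact.
Qed.

HB.instance Definition _ := isMeasure.Build _ _ _ cons_measure
  cons_measure0 cons_measure_ge0 cons_measure_sigma_additive.

Let cons_measure_sigma_finite : sigma_finite setT cons_measure.
Proof.
have /sigma_finiteP[F [FT ndF mF]] := sigma_finiteT (@lebesgue_measure R).
have /sigma_finiteP[G [GT ndG mG]] := sigma_finiteT m.
exists (fun k => (fun t : n.+1.-tuple T =>
                    (thead t, [tuple of behead t])) @^-1` (F k `*` G k)).
  rewrite -preimage_bigcup; apply/esym/seteqP; split => // t _.
  have [k _ Fk] : (\bigcup_i F i) (thead t) by rewrite -FT.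
  have [l _ Gl] : (\bigcup_i G i) [tuple of behead t] by rewrite -GT.
  exists (maxn k l) => //; split => /=.
  - by move: Fk; exact/subsetPset/ndF/leq_maxl.
  - by move: Gl; exact/subsetPset/ndG/leq_maxr.
move=> k; have [mFk Fk] := mF k; have [mGk Gk] := mG k; split.
  rewrite -[X in measurable X]setTI; apply: measurable_tuple_uncons => //.
  exact: measurableX.
rewrite /cons_measure /pushforward -comp_preimage.
rewrite (_ : _ \o _ = id); last first.
  by rewrite funeqE => -[a t] /=; congr pair; apply/val_inj.
by rewrite preimage_id product_measure1E// lte_mul_pinfty// ge0_fin_numE.
Qed.

HB.instance Definition _ := Measure_isSigmaFinite.Build _ _ _ cons_measure
  cons_measure_sigma_finite.

End cons_measure.

Lemma lebesgue_tuple_measure (R : realType) (n : nat) :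
  exists m : {sigma_finite_measure
                set (n.-tuple (measurableTypeR R)) -> \bar R},
    lebesgue_tuple R n = m.
Proof.
elim: n => [|n [m mE]]; first by exists (dirac [tuple]).
exists (cons_measure m).
by rewrite /= /cons_measure -mE.
Qed.

(* Integral over [A] with respect to n-dimensional Lebesgue measure. *)
Definition integral_rV (R : realType) (n : nat) (A : set 'rV[R]_n)
    (f : 'rV[R]_n -> R) : \bar R :=
  let v (t : n.-tuple (measurableTypeR R)) : 'rV[R]_n :=
    \row_(i < n) tnth t i in
  (\int[lebesgue_tuple R n]_(t in v @^-1` A) (f (v t))%:E)%E.

Definition hardy_inequality (R : realType) (n : nat) (Omega : set 'rV[R]_n)
    (p beta : R) : Prop :=
  exists2 C : R, 0 < C & forall u : 'rV[R]_n -> R, test_function Omega u ->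
    (integral_rV Omega (fun x => (`|u x| `^ p * bdist Omega x `^ (beta - p))%R)
     <= C%:E *
        integral_rV Omega
          (fun x => (enorm (grad u x) `^ p * bdist Omega x `^ beta)%R))%E.

(* Lehrbäck's density theorem in R^n.  [Omega = R^n], for which the distance to
   the boundary has no meaning, is excluded. *)
Definition lehrback_density_theorem (R : realType) (n : nat) : Prop :=
  forall (Omega : set 'rV[R]_n) (p lambda c : R),
    open Omega -> Omega != setT -> 1 < p -> 0 <= lambda <= n%:R - 1 ->
    density_condition Omega lambda c ->
    forall beta : R, beta < p - n%:R + lambda -> hardy_inequality Omega p beta.

(* Main.v *)
Require Import Defs.
From mathcomp Require Import all_boot all_order all_algebra.
From mathcomp Require Import all_classical all_reals all_analysis.
From mathcomp Require Import ring lra.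

(** Write d for the distance to the boundary.

    Exponents above n - 1 are impossible because the straight boundary seen from
    a point x is a Lipschitz graph in polar coordinates around x.  Let xi and
    xi' be two of its points, at radii rho >= rho' and in directions w and w'.
    The point y of [x, xi) at radius rho' lies at distance rho' |w - w'| from
    the boundary point xi', so the lower bound on d along [x, xi) forces
    rho - rho' to be at most a constant times |w - w'|
    ([straight_boundary_radial_graph]).  The directions fill a sphere of
    dimension n - 1; with the sup norm as radius, this sphere is the boundary of
    a cube, which splits into O(N^(n-1)) cells of size O(1/N)
    ([unit_sphere_labels]).  The bounded part of the straight boundary is
    therefore covered by O(N^(n-1)) balls of radius O(1/N), and its content in
    any dimension lambda > n - 1 is zero ([straight_boundary_content0]).  The
    criterion at a single point of Omega contradicts this.

    The density condition comes from applying the criterion at another point x'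
    ([segment_criterion_density]).  The ball of the criterion at x, of radius
    C0 d(x), may be larger than the ball of radius 2 d(x).  Moving from x
    towards a nearby boundary point by (1 - 1/C0) d(x) reaches a point x' with
    d(x') >= d(x)/C0 and almost equality; then the ball of radius C0 d(x')
    around x' lies in the ball of radius 2 d(x) around x, and the lower bound
    c0 d(x')^lambda is at least c0 C0^(-lambda) d(x)^lambda.

    The other assertions combine these two facts: for beta >= p - 1, the
    inequality beta < p - n + lambda would require lambda > n - 1. *)

Set Implicit Arguments.
Unset Strict Implicit.

Import Order.TTheory GRing.Theory Num.Theory.
Import numFieldNormedType.Exports.

Local Open Scope classical_set_scope.
Local Open Scope ring_scope.

(** * The Euclidean norm *)

Section euclidean_norm.
Context (R : realType) (n : nat).
Implicit Types x y z : 'rV[R]_n.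

Lemma enorm_ge0 x : 0 <= enorm x.
Proof. exact: sqrtr_ge0. Qed.

Lemma enorm_sqr x : enorm x ^+ 2 = \sum_(i < n) x ord0 i ^+ 2.
Proof. by rewrite sqr_sqrtr// sumr_ge0// => i _; exact: sqr_ge0. Qed.

Lemma coord_le_enorm x (i : 'I_n) : `|x ord0 i| <= enorm x.
Proof.
rewrite -sqrtr_sqr ler_sqrt; last by rewrite sumr_ge0// => j _; exact: sqr_ge0.
by rewrite (bigD1 i)//= lerDl sumr_ge0// => j _; exact: sqr_ge0.
Qed.

Lemma enormZ (a : R) x : enorm (a *: x) = `|a| * enorm x.
Proof.
rewrite /enorm -sqrtr_sqr -sqrtrM ?sqr_ge0// mulr_sumr.
by congr Num.sqrt; apply: eq_bigr => i _; rewrite mxE exprMn.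
Qed.

Lemma enorm_distC x y : enorm (x - y) = enorm (y - x).
Proof. by rewrite -opprB -scaleN1r enormZ normrN1 mul1r. Qed.

Lemma enorm0 : enorm (0 : 'rV[R]_n) = 0.
Proof. by rewrite -(scale0r 0) enormZ normr0 mul0r. Qed.

Lemma enorm_eq0 x : enorm x = 0 -> x = 0.
Proof.
move=> x0; apply/rowP => i; apply/eqP; rewrite mxE -normr_le0 -x0.
exact: coord_le_enorm.
Qed.

(** Writing [a] and [b] for the norms of [x] and [y], convexity of the square
    gives [a b (x_i + y_i)^2 <= (a + b) (b x_i^2 + a y_i^2)], the difference
    being [(b x_i - a y_i)^2]; summing over [i] yields the inequality. *)
Lemma enormD x y : enorm (x + y) <= enorm x + enorm y.
Proof.
have [x0|xn0] := eqVneq (enorm x) 0;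
  first by rewrite (enorm_eq0 x0) add0r enorm0 add0r.
have [y0|yn0] := eqVneq (enorm y) 0;
  first by rewrite (enorm_eq0 y0) addr0 enorm0 addr0.
have a_gt0 : 0 < enorm x by rewrite lt_def xn0 enorm_ge0.
have b_gt0 : 0 < enorm y by rewrite lt_def yn0 enorm_ge0.
set a := enorm x in a_gt0 *; set b := enorm y in b_gt0 *.
rewrite -ler_sqr ?nnegrE ?addr_ge0 ?enorm_ge0//.
rewrite -(ler_pM2l (mulr_gt0 a_gt0 b_gt0)).
have -> : a * b * (a + b) ^+ 2 = (a + b) * (b * a ^+ 2 + a * b ^+ 2) by ring.
rewrite !enorm_sqr !mulr_sumr -big_split/= mulr_sumr ler_sum// => i _.
rewrite mxE -subr_ge0.
set u := x ord0 i; set v := y ord0 i.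
have -> : (a + b) * (b * u ^+ 2 + a * v ^+ 2) - a * b * (u + v) ^+ 2 =
          (b * u - a * v) ^+ 2 by ring.
exact: sqr_ge0.
Qed.

Lemma enorm_distD y x z : enorm (x - z) <= enorm (x - y) + enorm (y - z).
Proof. by rewrite -{1}(subrK y x) -addrA enormD. Qed.

Lemma enorm_le_sup x (h : R) : (forall i, `|x ord0 i| <= h) -> 0 <= h ->
  enorm x <= Num.sqrt n%:R * h.
Proof.
move=> xh h0; rewrite -(ger0_norm h0) -sqrtr_sqr -sqrtrM ?ler0n//.
rewrite ler_sqrt ?mulr_ge0 ?sqr_ge0 ?ler0n//.
apply: (@le_trans _ _ (\sum_(i < n) h ^+ 2)).
  rewrite ler_sum// => i _.
  by rewrite -[leLHS]real_normK ?num_real// lerXn2r ?nnegrE.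
by rewrite sumr_const card_ord mulr_natl.
Qed.

Lemma sup_le_enorm x : `|x| <= enorm x.
Proof.
rewrite [leLHS]mx_normrE; apply/bigmax_leP; split=> [|[i j] _ /=].
  exact: enorm_ge0.
by rewrite ord1 coord_le_enorm.
Qed.

Lemma coord_le_sup x (i : 'I_n) : `|x ord0 i| <= `|x|.
Proof.
rewrite [leRHS]mx_normrE; apply/bigmax_geP; right => /=.
by exists (ord0, i).
Qed.

Lemma sup_attained x : x != 0 -> exists i, `|x ord0 i| = `|x|.
Proof.
rewrite -normr_eq0 => /mx_norm_neq0[[j i] /=]; rewrite ord1 => xE.
by exists i.
Qed.

End euclidean_norm.

(** * Boundaries and the distance to the boundary *)

(** Away from the boundary of [S] the closure and the interior of [S] agree, so
    [S] cuts out a clopen part of [A]. *)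
Lemma connected_meets_boundary (T : topologicalType) (A S : set T) :
  connected A -> A `&` S !=set0 -> A `&` ~` S !=set0 ->
  A `&` boundary S !=set0.
Proof.
move=> cA [x [Ax Sx]] [z [Az nSz]]; apply: contrapT => AbS.
have clint y : A y -> closure S y -> interior S y.
  by move=> Ay cSy; apply: contrapT => iSy; apply: AbS; exists y.
have AS : A `&` S = A.
  apply: cA; first by exists x.
  - exists (interior S); first exact: open_interior.
    apply/seteqP; split=> y [Ay Sy]; split=> //.
      by apply: clint => //; exact: subset_closure.
    exact: interior_subset.
  - exists (closure S); first exact: closed_closure.
    apply/seteqP; split=> y [Ay Sy]; split=> //.
      exact: subset_closure.
    by apply: (@interior_subset _ S); exact: clint.
by apply: nSz; move: Az; rewrite -AS => -[].
Qed.

Section boundary_distance.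
Context (R : realType) (n : nat).
Implicit Types (Omega : set 'rV[R]_n) (x y z : 'rV[R]_n).

Lemma segment_meets_boundary Omega x z : Omega x -> ~ Omega z ->
  exists2 t : R, 0 <= t <= 1 & boundary Omega ((1 - t) *: x + t *: z).
Proof.
move=> Ox Oz.
pose f (t : R) : 'rV[R]_n := (1 - t) *: x + t *: z.
have cf : continuous f.
  move=> t; apply: cvgD; apply: cvgZr_tmp; last exact: cvg_id.
  by apply: cvgB; [exact: cvg_cst|exact: cvg_id].
have cA : connected [set f t | t in `[(0 : R), 1]].
  apply: connected_continuous_connected; first exact: segment_connected.
  exact: continuous_subspaceT.
have [||_ [[t /= t01 <-] bt]] := @connected_meets_boundary _ _ Omega cA.
- exists x; split=> //; exists 0; rewrite /f /= ?in_itv/= ?lexx ?ler01//.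
  by rewrite subr0 scale1r scale0r addr0.
- exists z; split=> //; exists 1; rewrite /f /= ?in_itv/= ?lexx ?ler01//.
  by rewrite subrr scale1r scale0r add0r.
- by exists t => //; move: t01; rewrite in_itv.
Qed.

Lemma boundary_nonempty Omega : Omega !=set0 -> Omega != setT ->
  boundary Omega !=set0.
Proof.
move=> [x Ox] /eqP OT.
have [z Oz] : exists z, ~ Omega z.
  by apply/existsNP => Oall; apply: OT; apply/seteqP; split.
by have [t _ bt] := segment_meets_boundary Ox Oz; eexists; exact: bt.
Qed.

Lemma open_boundaryN Omega x : open Omega -> boundary Omega x -> ~ Omega x.
Proof. by move=> /interior_id oO [_]; rewrite oO. Qed.

Lemma bdist_le Omega x xi : boundary Omega xi -> bdist Omega x <= enorm (x - xi).
Proof.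
move=> bxi; apply: ge_inf; last by exists xi.
by exists 0 => _ [y _ <-]; exact: enorm_ge0.
Qed.

Lemma le_bdist Omega x (r : R) : boundary Omega !=set0 ->
  (forall xi, boundary Omega xi -> r <= enorm (x - xi)) -> r <= bdist Omega x.
Proof.
move=> [xi bxi] h; apply: lb_le_inf; first by exists (enorm (x - xi)), xi.
by move=> _ [y by_ <-]; exact: h.
Qed.

Lemma bdistD Omega x y : boundary Omega !=set0 ->
  bdist Omega x <= enorm (x - y) + bdist Omega y.
Proof.
move=> b0; rewrite -lerBlDl; apply: le_bdist => // xi bxi.
rewrite lerBlDl; apply: le_trans (enorm_distD y _ _).
exact: bdist_le.
Qed.

Lemma bdist_near Omega x (e : R) : boundary Omega !=set0 -> 0 < e ->
  exists2 xi, boundary Omega xi & enorm (x - xi) < bdist Omega x + e.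
Proof.
move=> b0 e0; apply: contrapT => nex.
have : bdist Omega x + e <= bdist Omega x.
  apply: le_bdist => // xi bxi; rewrite leNgt; apply/negP => lt.
  by apply: nex; exists xi.
by rewrite gerDl leNgt e0.
Qed.

Lemma bdist_gt0 Omega x : open Omega -> boundary Omega !=set0 -> Omega x ->
  0 < bdist Omega x.
Proof.
move=> oO b0 Ox.
have /nbhs_ballP[e /= e0 eO] : nbhs x Omega by exact: open_nbhs_nbhs.
apply: lt_le_trans e0 _; apply: le_bdist => // xi bxi.
rewrite leNgt; apply/negP => lt; apply: (open_boundaryN oO bxi); apply: eO.
by rewrite mx_norm_ball /ball_/=; apply: le_lt_trans lt; exact: sup_le_enorm.
Qed.

Lemma eball_bdist_sub Omega x : Omega x -> eball x (bdist Omega x) `<=` Omega.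
Proof.
move=> Ox z /= xz; apply: contrapT => Oz.
have [t /andP[t0 t1] bt] := segment_meets_boundary Ox Oz.
have := bdist_le x bt.
have -> : x - ((1 - t) *: x + t *: z) = t *: (x - z).
  by apply/rowP => i; rewrite !mxE; ring.
rewrite enormZ ger0_norm// enorm_distC leNgt => /negP; apply.
by apply: le_lt_trans xz; rewrite ler_piMl// enorm_ge0.
Qed.

End boundary_distance.

(** * Hausdorff content *)

Section content.
Context (R : realType) (n : nat).
Implicit Types (lambda r : R) (E F : set 'rV[R]_n).

Lemma le_hausdorff_content lambda E F : E `<=` F ->
  (hausdorff_content lambda E <= hausdorff_content lambda F)%E.
Proof.
move=> EF; apply: ereal_inf_le_tmp => _ [c [r [r0 Fr ->]]].
by exists c, r; split=> //; exact: subset_trans EF Fr.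
Qed.

(** Finite covers are handled through a labelling of the points: each label that
    occurs in [E] contributes the ball of radius [r] about one of its points. *)
Lemma hausdorff_content_labels lambda E (T : finType) (key : 'rV[R]_n -> T) r :
  0 < r ->
  (forall xi xi', E xi -> E xi' -> key xi = key xi' -> enorm (xi - xi') < r) ->
  (hausdorff_content lambda E <= (#|T|%:R * r `^ lambda)%:E)%E.
Proof.
move=> r0 Er.
have [ctr ctrP] : {ctr : T -> 'rV[R]_n |
    forall xi, E xi -> E (ctr (key xi)) /\ key (ctr (key xi)) = key xi}.
  have /choice[ctr ctrP] : forall k, exists y, forall xi, E xi -> key xi = k ->
      E y /\ key y = k.
    move=> k; have [[y [Ey ky]]|nex] := pselect (exists y, E y /\ key y = k).
      by exists y.
    by exists 0 => xi Exi kxi; case: nex; exists xi.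
  by exists ctr => xi Exi; exact: ctrP Exi _.
(* Labels are numbered by [enum_val]; the balls beyond the last label are
   empty, of radius 0. *)
pose c i := if insub i is Some j then ctr (@enum_val T predT j) else 0.
pose rad i := if (i < #|T|)%N then r else 0.
apply: ereal_inf_lbound; exists c, rad; split.
- by move=> i; rewrite /rad; case: ifP => // _; exact: ltW.
- move=> xi Exi; have [Ec kc] := ctrP _ Exi.
  exists (val (enum_rank (key xi))) => //.
  rewrite /eball/= /rad ltn_ord /c valK enum_rankK.
  by apply: Er => //; rewrite kc.
- rewrite (nneseries_split 0 #|T|); last first.
    by move=> k _; rewrite lee_fin; case: ifP => // _; exact: powR_ge0.
  rewrite add0n eseries0 ?adde0; last first.
    by move=> i Ti _; rewrite /rad ltnNge Ti/= eqxx.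
  rewrite (eq_big_nat _ _ (F2 := fun=> (r `^ lambda)%:E)); last first.
    by move=> i /andP[_ iT]; rewrite /rad iT gt_eqF.
  by rewrite sumEFin sumr_const_nat subn0 mulr_natl.
Qed.

End content.

(** * Radial graphs over the unit sphere *)

Section cube.
Context (R : realType) (m : nat).
Implicit Types (w : 'rV[R]_m.+1).

(** The unit sphere of the sup norm is the boundary of a cube.  A label records a
    coordinate where the norm is attained, its sign, that is the face of the
    cube, and the cell of a grid on this face, of dimension [m]. *)
Lemma unit_sphere_labels (N : nat) : (0 < N)%N ->
  exists key : 'rV[R]_m.+1 -> 'I_m.+1 * bool * {ffun 'I_m -> 'I_N.+1},
    forall w w', `|w| = 1 -> `|w'| = 1 -> key w = key w' ->
      enorm (w - w') <= Num.sqrt m.+1%:R * (2 / N%:R).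
Proof.
move=> N0; have N0R : 0 < N%:R :> R by rewrite ltr0n.
have /choice[top topP] : forall w, exists i, w != 0 -> `|w ord0 i| = `|w|.
  move=> w; have [->|/sup_attained[i wi]] := eqVneq w 0; first by exists ord0.
  by exists i.
(* [slot] sends [-1, 1] to [0, N]; the value [N] itself is attained at [a = 1],
   whence [N.+1] cells in each direction. *)
pose slot (a : R) := (a + 1) / 2 * N%:R.
have slotP a : `|a| <= 1 -> 0 <= slot a /\ (Num.truncn (slot a) < N.+1)%N.
  rewrite ler_norml => /andP[a_ge a_le].
  have s0 : 0 <= slot a by rewrite /slot !mulr_ge0 ?ler0n//; lra.
  split=> //; rewrite truncn_lt_nat//; apply: (@le_lt_trans _ _ N%:R).
    by rewrite /slot ler_piMl ?ler0n//; lra.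
  by rewrite ltr_nat.
pose key w := (top w, 0 <= w ord0 (top w),
  [ffun j => inord (Num.truncn (slot (w ord0 (lift (top w) j)))) : 'I_N.+1]).
exists key => w w' w1 w1'; rewrite /key => -[].
have wn0 : w != 0 by rewrite -normr_gt0 w1.
have wn0' : w' != 0 by rewrite -normr_gt0 w1'.
move: (topP w wn0) (topP w' wn0'); rewrite w1 w1'.
move: (top w) (top w') => i0 i1 wi wi' eqi; subst i0 => sgn cell.
apply: enorm_le_sup => [i|]; last by rewrite divr_ge0.
rewrite mxE [X in _ + X]mxE.
have [j ->|->] := unliftP i1 i.
  have /ffunP/(_ j) := cell; rewrite !ffunE => /(congr1 val)/=.
  have wj : `|w ord0 (lift i1 j)| <= 1 by rewrite -w1 coord_le_sup.
  have wj' : `|w' ord0 (lift i1 j)| <= 1 by rewrite -w1' coord_le_sup.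
  have [s0 sN] := slotP _ wj; have [s0' sN'] := slotP _ wj'.
  rewrite !inordK// => teq.
  move: (truncn_itv s0) (truncn_itv s0'); rewrite teq.
  set k := Num.truncn _; rewrite -natr1 /slot.
  move: (w _ _) (w' _ _) => a b /andP[ka ak] /andP[kb bk].
  rewrite ler_norml lerNl !ler_pdivlMr//.
  by apply/andP; split; lra.
(* On a common face the distinguished coordinates are both 1 or both -1. *)
have -> : w ord0 i1 = w' ord0 i1.
  move: wi wi' sgn; case: (leP 0 (w ord0 i1)) => h.
    by rewrite ger0_norm// => -> + /esym h'; rewrite ger0_norm.
  rewrite ltr0_norm// => wE + /esym/negbT; rewrite -ltNge => + h'.
  by rewrite ltr0_norm// -wE => /oppr_inj.
by rewrite subrr normr0 divr_ge0.
Qed.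

(** [E] is the image of a subset of an [m]-dimensional sphere under a Lipschitz
    map, the inverse of [f].  A grid of mesh [1/N] on the sphere gives a cover
    of cost [O(N ^ (m - lambda))], which tends to 0. *)
Lemma hausdorff_content_radial_graph (lambda L : R) (E : set 'rV[R]_m.+1)
    (f : 'rV[R]_m.+1 -> 'rV[R]_m.+1) :
  m%:R < lambda -> 0 <= L ->
  (forall xi, E xi -> `|f xi| = 1) ->
  (forall xi xi', E xi -> E xi' ->
     enorm (xi - xi') <= L * enorm (f xi - f xi')) ->
  (hausdorff_content lambda E <= 0)%E.
Proof.
move=> ml L0 f1 fL; apply/lee_addgt0Pr => e e0; rewrite add0e.
(* The term 1 makes room for the strict inequality in the definition of a
   ball; [A] bounds the cost of the cover, up to [N `^ (m - lambda)]. *)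
pose K : R := L * (Num.sqrt m.+1%:R * 2) + 1.
have K0 : 0 < K by rewrite ltr_wpDl// !mulr_ge0.
pose A : R := (m.+1 * 2 * 2 ^ m)%:R * K `^ lambda.
have dl : 0 < lambda - m%:R by rewrite subr_gt0.
have A0 : 0 <= A by rewrite mulr_ge0 ?powR_ge0.
pose N := (Num.truncn ((A / e) `^ (lambda - m%:R)^-1)).+1.
have N0 : 0 < N%:R :> R by rewrite ltr0n.
(* The choice of [N] makes the cost of the cover at most [e]. *)
have AN : A <= e * N%:R `^ (lambda - m%:R).
  rewrite mulrC -ler_pdivrMr//.
  have Ae : 0 <= A / e by rewrite divr_ge0// ltW.
  have -> : A / e = ((A / e) `^ (lambda - m%:R)^-1) `^ (lambda - m%:R).
    by rewrite -powRrM mulVf ?gt_eqF// powRr1.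
  apply: ge0_ler_powR; rewrite ?nnegrE ?powR_ge0 ?ler0n//; first exact: ltW.
  by apply/ltW/truncnS_gt.
have [key keyP] := @unit_sphere_labels N isT.
have KN0 : 0 < K / N%:R by rewrite divr_gt0.
apply: le_trans (hausdorff_content_labels lambda (key := key \o f) KN0 _) _.
  move=> xi xi' Exi Exi' kE; apply: le_lt_trans (fL _ _ Exi Exi') _.
  have /(ler_wpM2l L0)/le_lt_trans := keyP _ _ (f1 _ Exi) (f1 _ Exi') kE; apply.
  by rewrite !mulrA ltr_pM2r ?invr_gt0// /K mulrA ltrDl.
rewrite lee_fin !card_prod card_bool card_ffun !card_ord.
rewrite powRM ?(ltW K0) ?invr_ge0 ?(ltW N0)//.
have -> : (N%:R^-1 : R) `^ lambda = (N%:R `^ lambda)^-1.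
  by rewrite -powR_inv1 ?ltW// -powRrM mulN1r powRN.
have -> : N%:R `^ lambda = N%:R ^+ m * N%:R `^ (lambda - m%:R) :> R.
  by rewrite -powR_mulrn ?ltW// -powRD ?(gt_eqF N0) ?implybT// subrKC.
apply: (@le_trans _ _ (A * (N%:R `^ (lambda - m%:R))^-1)); last first.
  by rewrite ler_pdivrMr// powR_gt0.
rewrite invfM !mulrA ler_wpM2r ?invr_ge0 ?powR_ge0//.
rewrite ler_pdivrMr ?exprn_gt0// /A mulrAC ler_wpM2r ?powR_ge0//.
rewrite -natrX -natrM ler_nat -[leqRHS]mulnA -expnMn leq_mul//.
have [->|m0] := posnP m; first by rewrite !expn0.
by rewrite leq_exp2r// mul2n -addnn addSn ltnS leq_addl.
Qed.

End cube.

(** * Consequences of the segment criterion *)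

Section straight_boundary.
Context (R : realType).

(** The sup norm is the radius here, so that directions lie on the boundary of a
    cube.  With [y] the point of [[x, xi)] at the radius of [xi'], the distance
    from [xi] to [xi'] is at most the radial part [enorm (xi - y)] plus the
    angular part [enorm (y - xi')].  Since [xi'] is a boundary point, the angular
    part is at least the distance from [y] to the boundary; straightness bounds
    this distance from below, and so the radial part by [D / alpha] times the
    distance between the directions. *)
Lemma straight_boundary_radial_graph (n : nat) (Omega : set 'rV[R]_n)
    (x xi xi' : 'rV[R]_n) (alpha D : R) :
  open Omega -> Omega x -> 0 < alpha ->
  straight_boundary Omega x alpha xi -> straight_boundary Omega x alpha xi' ->
  enorm (xi - x) <= D -> enorm (xi' - x) <= D ->
  enorm (xi - xi') <= (alpha^-1 + 1) * D *
    enorm (`|xi - x|^-1 *: (xi - x) - `|xi' - x|^-1 *: (xi' - x)).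
Proof.
move=> oO Ox a0.
wlog le_rho : xi xi' / `|xi' - x| <= `|xi - x|.
  move=> H S S' xiD xiD'.
  have [le|/ltW le] := leP `|xi' - x| `|xi - x|; first exact: H.
  by rewrite enorm_distC [X in _ * X]enorm_distC; apply: H.
move=> [bxi _ far] [bxi' _ _] xiD xiD'.
have rho_gt0 z : boundary Omega z -> 0 < `|z - x|.
  move=> bz; rewrite normr_gt0 subr_eq0; apply/eqP => zx.
  by apply: (open_boundaryN oO bz); rewrite zx.
have rho0 := rho_gt0 _ bxi; have rho'0 := rho_gt0 _ bxi'.
set e := enorm (_ - _ *: _).
pose t := `|xi' - x| / `|xi - x|.
pose y := (1 - t) *: x + t *: xi.
have D0 : 0 <= D by apply: le_trans xiD; exact: enorm_ge0.
have e0 : 0 <= e by exact: enorm_ge0.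
have yxi' : enorm (y - xi') = `|xi' - x| * e.
  rewrite -[X in X * _]ger0_norm// -enormZ scalerBr !scalerA divff ?gt_eqF//.
  rewrite -/t scale1r; congr enorm.
  by apply/rowP => i; rewrite !mxE; ring.
have rho'D : `|xi' - x| * e <= D * e.
  by rewrite ler_wpM2r// (le_trans _ xiD')// sup_le_enorm.
have t0 : 0 < t by rewrite divr_gt0.
have t1 : t <= 1 by rewrite ler_pdivrMr// mul1r.
have xiy : enorm (xi - y) = (1 - t) * enorm (x - xi).
  rewrite enorm_distC -(ger0_norm (_ : 0 <= 1 - t)) ?subr_ge0// -enormZ.
  by congr enorm; apply/rowP => i; rewrite !mxE; ring.
suff step : alpha * ((1 - t) * enorm (x - xi)) <= D * e.
  apply: le_trans (enorm_distD y _ _) _.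
  rewrite -mulrA mulrDl mul1r lerD//; last by rewrite yxi'.
  by rewrite xiy [leRHS]mulrC ler_pdivlMr// mulrC.
move: t1; rewrite le_eqVlt => /predU1P[->|t1].
  by rewrite subrr mul0r mulr0 mulr_ge0.
have dy := far t; rewrite t0 t1 in dy.
have {dy} := le_trans (dy isT) (bdist_le _ bxi'); rewrite -/y yxi'.
(* If [1 - t] is the minimum, straightness is the bound on [enorm (xi - y)]
   itself.  Otherwise it forces [alpha <= e], and the crude bound
   [enorm (xi - y) <= D] suffices. *)
have [tle|tlt] := leP t (1 - t); last first.
  by rewrite -mulrA => /le_trans; apply.
move=> near.
have ae : alpha <= e.
  rewrite -(ler_pM2r rho'0) [leRHS]mulrC; apply: le_trans near.
  rewrite -mulrA ler_pM2l//.
  have -> : `|xi' - x| = t * `|xi - x| by rewrite /t divfK ?gt_eqF.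
  by rewrite ler_pM2l// enorm_distC sup_le_enorm.
rewrite mulrC ler_pM ?mulr_ge0 ?enorm_ge0 ?subr_ge0 ?(ltW a0) ?(ltW t1)//.
rewrite enorm_distC; apply: le_trans xiD.
by rewrite ler_piMl ?enorm_ge0// gerBl ltW.
Qed.

Lemma straight_boundary_content0 (m : nat) (Omega : set 'rV[R]_m.+1)
    (x : 'rV[R]_m.+1) (alpha D lambda : R) :
  open Omega -> Omega x -> 0 < alpha -> 0 <= D -> m%:R < lambda ->
  (hausdorff_content lambda
     (straight_boundary Omega x alpha `&` eball x D) <= 0)%E.
Proof.
move=> oO Ox a0 D0 ml.
apply: (@hausdorff_content_radial_graph R m lambda ((alpha^-1 + 1) * D) _
  (fun xi => `|xi - x|^-1 *: (xi - x))) => //.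
- by rewrite mulr_ge0// addr_ge0// invr_ge0 ltW.
- move=> xi [[bxi _ _] _].
  rewrite normrZ ger0_norm ?invr_ge0// mulVf// normr_eq0 subr_eq0.
  by apply/eqP => xix; apply: (open_boundaryN oO bxi); rewrite xix.
- move=> xi xi' [S /ltW xiD] [S' /ltW xiD'].
  exact: (straight_boundary_radial_graph oO Ox a0 S S').
Qed.

Lemma segment_criterion_exponent (n : nat) (Omega : set 'rV[R]_n)
    (lambda c0 C0 alpha : R) : (0 < n)%N -> domain Omega -> Omega != setT ->
  segment_criterion Omega lambda c0 C0 alpha -> lambda <= n%:R - 1.
Proof.
case: n Omega => // m Omega _ [oO _ O0] OT [c00 C02 /andP[a0 _] _ S].
rewrite leNgt; apply/negP => ml.
have [x Ox] := O0.
have d0 := bdist_gt0 oO (boundary_nonempty O0 OT) Ox.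
have mlt : m%:R < lambda by rewrite -natr1 addrK in ml.
have D0 : 0 <= C0 * bdist Omega x by
  rewrite mulr_ge0 ?(ltW d0)// (le_trans _ C02).
have := le_trans (S x Ox) (straight_boundary_content0 oO Ox a0 D0 mlt).
by rewrite lee_fin leNgt mulr_gt0// powR_gt0.
Qed.

(** The criterion is applied at a point [x'] closer to the boundary, where its
    ball, of radius [C0 * bdist Omega x'], fits into the ball of radius
    [2 * bdist Omega x] around [x]. *)
Lemma segment_criterion_density (n : nat) (Omega : set 'rV[R]_n)
    (lambda c0 C0 alpha : R) :
  open Omega -> boundary Omega !=set0 ->
  segment_criterion Omega lambda c0 C0 alpha ->
  density_condition Omega lambda (c0 * C0 `^ (- lambda)).
Proof.
move=> oO b0 [c00 C02 _ /andP[l0 _] S].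
have C00 : 0 < C0 by apply: lt_le_trans C02.
split=> [|x Ox]; first by rewrite mulr_gt0// powR_gt0.
set d := bdist Omega x.
have d0 : 0 < d by exact: bdist_gt0.
have Ci0 : 0 < C0^-1 by rewrite invr_gt0.
have Ci1 : C0^-1 < 1 by rewrite invf_lt1//; apply: lt_le_trans C02; rewrite ltr1n.
(* The tolerance [d / C0 ^+ 2] costs [d / C0] in the radius of the new ball,
   which is the room left in [d + (1 - C0^-1) * d <= 2 * d]. *)
have e0 : 0 < d / C0 ^+ 2 by rewrite divr_gt0// exprn_gt0.
have [xi bxi xid] := bdist_near x b0 e0.
rewrite -/d in xid.
have dxi : d <= enorm (x - xi) by exact: bdist_le.
have rho0 : 0 < enorm (x - xi) by exact: lt_le_trans dxi.
pose s := (1 - C0^-1) * d; pose t := s / enorm (x - xi).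
have s0 : 0 < s by rewrite mulr_gt0// subr_gt0.
have sd : s < d by rewrite /s gtr_pMl// gtrBl.
have t0 : 0 < t by rewrite divr_gt0.
have t1 : t <= 1 by rewrite ler_pdivrMr// mul1r (le_trans _ dxi)// ltW.
pose x' := (1 - t) *: x + t *: xi.
have xx' : enorm (x - x') = s.
  have -> : x - x' = t *: (x - xi) by apply/rowP => i; rewrite !mxE; ring.
  by rewrite enormZ gtr0_norm// divfK// gt_eqF.
have x'xi : enorm (x' - xi) = enorm (x - xi) - s.
  have -> : x' - xi = (1 - t) *: (x - xi) by apply/rowP => i; rewrite !mxE; ring.
  by rewrite enormZ ger0_norm ?subr_ge0// mulrBl mul1r divfK// gt_eqF.
have Ox' : Omega x'.
  by apply: (eball_bdist_sub Ox); rewrite /eball/= enorm_distC xx'.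
have d_ge : d / C0 <= bdist Omega x'.
  have := bdistD x x' b0; rewrite xx' -/d /s; lra.
have d_le : C0 * bdist Omega x' + s <= 2 * d.
  have : bdist Omega x' <= d / C0 + d / C0 ^+ 2.
    by apply: le_trans (bdist_le _ bxi) _; rewrite x'xi /s; lra.
  rewrite -(ler_pM2l C00) => h.
  have hE : C0 * (d / C0 + d / C0 ^+ 2) = d + C0^-1 * d.
    by field; rewrite gt_eqF.
  by rewrite hE in h; rewrite /s; lra.
apply: (@le_trans _ _ (c0 * bdist Omega x' `^ lambda)%:E).
  rewrite lee_fin -mulrA ler_pM2l// powRN.
  have -> : (C0 `^ lambda)^-1 = (C0^-1) `^ lambda.
    by rewrite -[in RHS]powR_inv1 ?ltW// -powRrM mulN1r powRN.
  rewrite -powRM ?(ltW Ci0) ?(ltW d0)// mulrC; apply: ge0_ler_powR => //.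
    by rewrite nnegrE ltW// divr_gt0.
  by rewrite nnegrE (le_trans _ d_ge)// ltW// divr_gt0.
apply: le_trans (S _ Ox') _; apply: le_hausdorff_content => y [[by_ _ _] /= yx'].
split=> //; rewrite /eball/=; apply: lt_le_trans d_le.
apply: le_lt_trans (enorm_distD x' _ _) _.
by rewrite [X in _ + X]enorm_distC xx' ltrD2r.
Qed.

End straight_boundary.

Theorem theorem4p2 (R : realType) (n : nat) (hn : (0 < n)%N)
    (Omega : set 'rV[R]_n) (hdom : domain Omega) (hproper : Omega != setT)
    (p : R) (hp : 1 < p) :
  [/\ (* (i) *)
      forall lambda : R, n%:R - 1 < lambda ->
        forall c0 C0 alpha : R, ~ segment_criterion Omega lambda c0 C0 alpha,
      (* (ii) *)
      forall lambda c0 C0 alpha : R, 0 <= lambda <= n%:R - 1 ->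
        segment_criterion Omega lambda c0 C0 alpha ->
        density_condition Omega lambda (c0 * C0 `^ (- lambda)) /\
        (lehrback_density_theorem R n ->
         forall beta : R, beta < p - n%:R + lambda ->
           hardy_inequality Omega p beta),
      (* no exponent beta >= p - 1 is in the range of a segment criterion *)
      forall beta : R, p - 1 <= beta ->
        ~ (exists lambda c0 C0 alpha : R,
             segment_criterion Omega lambda c0 C0 alpha /\
             beta < p - n%:R + lambda) &
      (* for beta < p - 1, wherever a segment criterion applies, so does
         the density theorem *)
      forall beta : R, beta < p - 1 ->
        forall lambda c0 C0 alpha : R,
          segment_criterion Omega lambda c0 C0 alpha ->
          beta < p - n%:R + lambda ->
          0 <= lambda <= n%:R - 1 /\
          (exists c : R, density_condition Omega lambda c)].
Proof.
have [oO _ O0] := hdom.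
have b0 := boundary_nonempty O0 hproper.
have exponent lambda c0 C0 alpha :
    segment_criterion Omega lambda c0 C0 alpha -> lambda <= n%:R - 1.
  exact: segment_criterion_exponent.
have density lambda c0 C0 alpha : segment_criterion Omega lambda c0 C0 alpha ->
    density_condition Omega lambda (c0 * C0 `^ (- lambda)).
  exact: segment_criterion_density.
split.
- by move=> lambda nl c0 C0 alpha /exponent; rewrite leNgt nl.
- move=> lambda c0 C0 alpha l0n S; split=> [|lehrback beta betalt];
    first exact: density S.
  exact: lehrback oO hproper hp l0n (density _ _ _ _ S) _ betalt.
- move=> beta beta_ge [lambda [c0 [C0 [alpha [/exponent ln]]]]].
  by apply/negP; rewrite -leNgt; lra.
- move=> beta _ lambda c0 C0 alpha S _; split; last by eexists; exact: density S.
  by have [_ _ _ /andP[-> _] _] := S; exact: exponent S.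
Qed.
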